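(* Let $G_s=(V,E,P_s)$ be a signed graph with $V=\{1,\dots,n\}$ whose sign pattern admits only real eigenvalues, i.e. every $A\in\mathcal{Q}_s(G_s)$ has only real eigenvalues. Let $V_C=\{j_1,\ldots,j_m\}\subseteq V$ be a set of control nodes and $B=[e_{j_1},\ldots,e_{j_m}]$. If $V_C$ is a signed zero forcing set, a positive signed zero forcing set, and a negative signed zero forcing set of $G_s$, then $(G_s,V_C)$ is controllable, i.e. for every $A\in\mathcal{Q}_s(G_s)$, every eigenvalue of $A$ is a controllable eigenvalue of the LTI system $\dot x=Ax+Bu$.
   Context: **Sign patterns and signed graphs.** $\mathrm{sign}:\mathbb{R}\to\{+,-,0\}$ is the sign function, and $\mathrm{inv}(+)=-$, $\mathrm{inv}(-)=+$. A sign pattern $P_s$ is an $n\times n$ matrix whose off-diagonal entries lie in $\{+,-,0\}$ and whose diagonal entries lie in $\{+,-,0,?\}$. A real matrix $A\in\mathbb{R}^{n\times n}$ has sign pattern $P_s$ if $(P_s)_{ij}=\mathrm{sign}(A_{ij})$ for all $i\ne j$ and $(P_s)_{ii}=\mathrm{sign}(A_{ii})$ whenever $(P_s)_{ii}\neq ?$; if $(P_s)_{ii}=?$, $A_{ii}$ is an arbitrary real number. A signed graph $G_s=(V,E,P_s)$ has $V=\{1,\dots,n\}$ and $(i,j)\in E$ (an edge from $i$ to $j$) iff $(P_s)_{ji}\neq 0$; the edge $(i,j)$ carries the label $(P_s)_{ji}$. Self-loops are allowed and may carry the label $+$, $-$ or $?$. $N_{out}(v)=\{u:(v,u)\in E\}$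 (it contains $v$ if $v$ has a self-loop). The qualitative class $\mathcal{Q}_s(G_s)$ is the set of all real $n\times n$ matrices with sign pattern $P_s$; if $G_s$ is considered as an undirected signed graph ($P_s$ symmetric), $\mathcal{Q}_s(G_s)$ is the set of all symmetric real matrices with sign pattern $P_s$. **Looped graphs.** $P_s^{+}$ (resp. $P_s^{-}$) is obtained from $P_s$ by adding $+$ (resp. $-$) to every diagonal entry using the rules $?+s=?$, $0+s=s$, $r+r=r$, $r+\mathrm{inv}(r)=?$ for $r\in\{+,-\}$. The positive looped graph is $G_s^+=(V,E,P_s^+)$ and the negative looped graph is $G_s^-=(V,E,P_s^-)$, where the edge sets are those determined by $P_s^+$, $P_s^-$ (so every node has a self-loop). **Signing and coloring game** on a signed graph with pattern $P_s$. Each node is black or white; each white node $u$ is either marked, with $m(u)\in\{+,-\}$, or unmarked, $m(u)=*$. A node turned black has sign zero and is no longer counted as marked. Initially the nodes of a given set $Z\subseteq V$ are black, all others are white and unmarked. For $v\in V$ let $W(v)$ be the set of white out-neighbors of $v$, $W_+(v)=\{u\in W(v): m(u)=(P_s)_{uv}\}$, $W_-(v)=\{u\in W(v): m(u)=\mathrm{inv}((P_s)_{uv})\}$, $W_*(v)=\{u\in W(v): m(u)=*\}$. Let $v$ be a node that is either black, or white with $(P_s)_{vv}\neq ?$. The allowed moves are: 1. If $W(v)=\{u\}$, then $u$ becomes black (possibly $u=v$). 2. If $W_+(v)=W(v)$ or $W_-(v)=W(v)$, then all nodes of $W(v)$ become black. 3. If for some $s\in\{+,-\}$, $W_s(v)\ne\emptyset$,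 $W_{\mathrm{inv}(s)}(v)=\emptyset$ and $W_*(v)=\{w\}$, then $w$ is marked with the product of signs $(P_s)_{wv}\cdot\mathrm{inv}(s)$. 4. If no white node of the graph is marked and $u\in V$ is white, then $u$ may be marked with $+$. The moves are applied as many times as possible. The set $Z$ is a *signed zero forcing set* of $G_s$ if all nodes become black when the game is played on $G_s$ (for some sequence of moves). It is a *positive signed zero forcing set* of $G_s$ if all nodes become black when the game is played on the negative looped graph $G_s^-$ (with pattern $P_s^-$ in place of $P_s$), and a *negative signed zero forcing set* of $G_s$ if all nodes become black when the game is played on the positive looped graph $G_s^+$ (with pattern $P_s^+$). **Controllability of eigenvalues.** $e_j$ is the $j$th column of $I_n$. If $(A,B)$ is controllable, all eigenvalues of $A$ are controllable. Otherwise there is a nonsingular $T$ with $T^{-1}AT=\begin{bmatrix}\hat A_{11}&\hat A_{12}\\0&\hat A_{22}\end{bmatrix}$, $T^{-1}B=\begin{bmatrix}\hat B_1\\0\end{bmatrix}$, $(\hat A_{11},\hat B_1)$ controllable, and an eigenvalue $\lambda$ of $A$ is a controllable eigenvalue if it is not an eigenvalue of $\hat A_{22}$. Equivalently (Popov–Belevitch–Hautus test), $w^TB\ne 0$ for every nonzero $w$ with $w^TA=\lambda w^T$. *)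

(* Defs.v *)
From HB Require Import structures.
From Stdlib Require Import Relation_Operators.
From mathcomp Require Import all_boot all_order all_algebra.
From mathcomp Require Import complex.
From mathcomp Require Import reals topology normedtype derive.

Set Implicit Arguments.
Unset Strict Implicit.
Unset Printing Implicit Defensive.

Import Order.TTheory GRing.Theory Num.Theory.
Import numFieldNormedType.Exports.

Local Open Scope ring_scope.

Inductive pm := Plus | Minus.

(* [Any] is the label "?", which only occurs on the diagonal. *)
Inductive label := Signed of pm | Zero | Any.

Definition pm_eqb (s t : pm) : bool :=
  match s, t with Plus, Plus | Minus, Minus => true | _, _ => false end.

Lemma pm_eqbP : Equality.axiom pm_eqb.
Proof. by case; case; constructor. Qed.

HB.instance Definition _ := hasDecEq.Build pm pm_eqbP.

Definition label_eqb (a b : label) : bool :=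
  match a, b with
  | Signed s, Signed t => s == t
  | Zero, Zero | Any, Any => true
  | _, _ => false
  end.

Lemma label_eqbP : Equality.axiom label_eqb.
Proof.
case=> [s||]; case=> [t||]; try by constructor.
by apply: (iffP eqP) => [->|[]].
Qed.

HB.instance Definition _ := hasDecEq.Build label label_eqbP.

Definition inv_pm (s : pm) : pm :=
  match s with Plus => Minus | Minus => Plus end.

Definition mul_pm (s t : pm) : pm :=
  match s with Plus => t | Minus => inv_pm t end.

Definition add_label (a : label) (s : pm) : label :=
  match a with
  | Zero => Signed s
  | Signed r => if r == s then Signed r else Any
  | Any => Any
  end.

Definition sign_label (R : realType) (x : R) : label :=
  if x == 0 then Zero else Signed (if 0 < x then Plus else Minus).

(* The flag [undirected] records whether the graph is considered as an
   undirected one; it only affects the qualitative class. *)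
Record signed_graph (n : nat) := SignedGraph {
  pattern : 'M[label]_n;
  undirected : bool;
  pattern_offdiag : forall i j, i != j -> pattern i j != Any;
  pattern_sym : undirected -> pattern^T = pattern
}.

Definition has_sign_pattern (R : realType) (n : nat)
    (P : 'M[label]_n) (A : 'M[R]_n) : Prop :=
  forall i j, P i j != Any -> P i j = sign_label (A i j).

Definition qualitative_class (R : realType) (n : nat) (G : signed_graph n)
    (A : 'M[R]_n) : Prop :=
  has_sign_pattern (pattern G) A /\ (undirected G -> A^T = A).

Definition looped_pattern (n : nat) (s : pm) (P : 'M[label]_n) : 'M[label]_n :=
  \matrix_(i, j) (if i == j then add_label (P i j) s else P i j).

(* [White None] is a white unmarked node. *)
Inductive status := Black | White of option pm.

Definition is_black (x : status) : bool :=
  if x is Black then true else false.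

Definition is_unmarked (x : status) : bool :=
  if x is White None then true else false.

Definition is_marked (x : status) : bool :=
  if x is White (Some _) then true else false.

Section Game.
Variables (n : nat) (P : 'M[label]_n).

Definition state := 'I_n -> status.

Definition initial_state (Z : {set 'I_n}) : state :=
  fun u => if u \in Z then Black else White None.

(* The label of the edge from v to u is P u v. *)
Definition white_out (st : state) (v : 'I_n) : {set 'I_n} :=
  [set u | (P u v != Zero) && ~~ is_black (st u)].

(* For s = Plus the mark of u equals P u v, for s = Minus the mark of u is the
   inverse of P u v. *)
Definition white_out_marked (s : pm) (st : state) (v : 'I_n) : {set 'I_n} :=
  [set u in white_out st v |
     if st u is White (Some m) then P u v == Signed (mul_pm s m) else false].

Definition white_out_unmarked (st : state) (v : 'I_n) : {set 'I_n} :=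
  [set u in white_out st v | is_unmarked (st u)].

Definition may_act (st : state) (v : 'I_n) : bool :=
  is_black (st v) || (P v v != Any).

Definition blacken (S : {set 'I_n}) (st : state) : state :=
  fun u => if u \in S then Black else st u.

Definition mark (w : 'I_n) (m : pm) (st : state) : state :=
  fun u => if u == w then White (Some m) else st u.

Inductive move (st : state) : state -> Prop :=
| MoveForce v u :
    may_act st v -> white_out st v = [set u] ->
    move st (blacken [set u] st)
| MoveCoherent v s :
    may_act st v -> white_out_marked s st v = white_out st v ->
    move st (blacken (white_out st v) st)
| MoveMark v s w p :
    may_act st v ->
    white_out_marked s st v != set0 ->
    white_out_marked (inv_pm s) st v = set0 ->
    white_out_unmarked st v = [set w] ->
    P w v = Signed p ->
    move st (mark w (mul_pm p (inv_pm s)) st)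
| MoveStart u :
    (forall x, ~~ is_marked (st x)) -> ~~ is_black (st u) ->
    move st (mark u Plus st).

Definition forces_all (Z : {set 'I_n}) : Prop :=
  exists st : state,
    clos_refl_trans_1n state move (initial_state Z) st /\
    forall u, is_black (st u).

End Game.

Definition signed_zfs (n : nat) (G : signed_graph n) (Z : {set 'I_n}) : Prop :=
  forces_all (pattern G) Z.

Definition positive_signed_zfs (n : nat) (G : signed_graph n)
    (Z : {set 'I_n}) : Prop :=
  forces_all (looped_pattern Minus (pattern G)) Z.

Definition negative_signed_zfs (n : nat) (G : signed_graph n)
    (Z : {set 'I_n}) : Prop :=
  forces_all (looped_pattern Plus (pattern G)) Z.

(* Spectrum over the complex numbers of a real matrix. *)
Definition complex_eigenvalue (R : realType) (n : nat) (A : 'M[R]_n)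
    (l : R[i]) : Prop :=
  eigenvalue (map_mx (real_complex R) A) l.

Definition only_real_eigenvalues (R : realType) (n : nat) (A : 'M[R]_n) : Prop :=
  forall l : R[i], complex_eigenvalue A l -> complex.Im l = 0.

Definition control_matrix (R : realType) (n m : nat) (j : 'I_m -> 'I_n) :
    'M[R]_(n, m) :=
  \matrix_(i, k) (i == j k)%:R.

Definition trajectory (R : realType) (n m : nat) (A : 'M[R]_n)
    (B : 'M[R]_(n, m)) (u : R -> 'cV[R]_m) (x : R -> 'cV[R]_n) : Prop :=
  forall t : R, is_derive t 1 x (A *m x t + B *m u t).

(* Every initial state can be steered to every final state in finite time, by
   a continuous input. *)
Definition controllable (R : realType) (n m : nat) (A : 'M[R]_n)
    (B : 'M[R]_(n, m)) : Prop :=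
  forall x0 x1 : 'cV[R]_n,
    exists (tf : R) (u : R -> 'cV[R]_m) (x : R -> 'cV[R]_n),
      [/\ 0 < tf,
          continuous u,
          trajectory A B u x,
          x 0 = x0
        & x tf = x1].

(* The change of basis T is typed as an n x (r + s) matrix with two-sided
   inverse T', which forces r + s = n and avoids casts. *)
Definition kalman_decomposition (R : realType) (n m r s : nat)
    (A : 'M[R]_n) (B : 'M[R]_(n, m))
    (T : 'M[R]_(n, r + s)) (T' : 'M[R]_(r + s, n))
    (A11 : 'M[R]_r) (A12 : 'M[R]_(r, s)) (A22 : 'M[R]_s)
    (B1 : 'M[R]_(r, m)) : Prop :=
  [/\ T *m T' = 1%:M,
      T' *m T = 1%:M,
      T' *m A *m T = block_mx A11 A12 0 A22,
      T' *m B = col_mx B1 0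
    & controllable A11 B1].

(* The spectrum of A22 does not depend on the chosen decomposition. *)
Definition controllable_eigenvalue (R : realType) (n m : nat) (A : 'M[R]_n)
    (B : 'M[R]_(n, m)) (l : R[i]) : Prop :=
  complex_eigenvalue A l /\
  (controllable A B \/
   exists (r s : nat) (T : 'M[R]_(n, r + s)) (T' : 'M[R]_(r + s, n))
          (A11 : 'M[R]_r) (A12 : 'M[R]_(r, s)) (A22 : 'M[R]_s)
          (B1 : 'M[R]_(r, m)),
     kalman_decomposition A B T T' A11 A12 A22 B1 /\
     ~ complex_eigenvalue A22 l).

(* Main.v *)
Require Import Defs.
From mathcomp Require Import all_boot all_order all_algebra.
From mathcomp Require Import complex.
From mathcomp Require Import reals topology normedtype derive.
From mathcomp Require Import ring lra.

(** Under the hypotheses the pair [(A, B)] is controllable, so that every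
    eigenvalue is.

    The zero forcing conditions give the eigenvector test.  Suppose that
    [w *m A = l *: w] and [w] vanishes on the control nodes.  The eigenvalue
    [l] is real, and [A - l I] has the pattern of [G], of its negative looped
    graph or of its positive looped graph, according to the sign of [l].
    Column [v] of [w *m (A - l I) = 0] says that the signed contributions of
    the out-neighbors of [v] add up to zero.  In a play of the game every black
    node has a zero entry in [w], and a mark is the sign of the entry if that is
    nonzero, up to one global sign ([compatible_move]); when all nodes are black,
    [w = 0] ([zero_forcing_left_eigenvector]).

    The eigenvector test gives the rank condition: the characteristic polynomial
    splits over the reals, so a nonzero row vector that annihilates every
    [A ^+ k *m B] yields a real left eigenvector with the same property
    ([kalman_rank_real]).

    The rank condition gives steering, here by polynomial states and inputs on
    the interval from 0 to 1 ([kalman_rank_controllable]).  Call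
    [x' - A x] the defect of a curve [x]; an input exists when the defect
    lies in the range of [B].  A polynomial curve with the prescribed endpoints
    can be corrected so that its defect vanishes to any order at both ends
    ([endpoints_with_flat_defect]).  By the rank condition that defect is a sum
    of terms [A ^+ k *m B *m f k], and such a term is moved into the range of
    [B] by a correction that vanishes at the ends
    ([absorb_reachable_direction]).  Only algebra over the polynomial ring is
    needed, neither a matrix exponential nor an integral. *)

Set Implicit Arguments.
Unset Strict Implicit.
Unset Printing Implicit Defensive.

Import Order.TTheory GRing.Theory Num.Theory.
Import numFieldNormedType.Exports.
Local Open Scope ring_scope.

Definition pm_sign (R : nzRingType) (s : pm) : R := if s is Plus then 1 else -1.

Lemma pm_signM (R : nzRingType) s t :
  pm_sign R (mul_pm s t) = pm_sign R s * pm_sign R t.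
Proof. by case: s; case: t; rewrite /= ?mul1r ?mulN1r ?opprK. Qed.

Lemma pm_signV (R : nzRingType) s : pm_sign R (inv_pm s) = - pm_sign R s.
Proof. by case: s; rewrite /= ?opprK. Qed.

Lemma pm_sign_sqr (R : nzRingType) s : pm_sign R s * pm_sign R s = 1.
Proof. by case: s; rewrite /= ?mul1r ?mulN1r ?opprK. Qed.

Lemma sign_labelP (R : realType) (x : R) p :
  sign_label x = Signed p <-> 0 < pm_sign R p * x.
Proof.
rewrite /sign_label; have [xneg|xpos|->] := ltrgtP x 0.
- by case: p; rewrite /= ?mul1r ?mulN1r ?oppr_gt0 ?xneg ?(lt_gtF xneg).
- by case: p; rewrite /= ?mul1r ?mulN1r ?oppr_gt0 ?xpos ?(lt_gtF xpos).
- by rewrite mulr0 ltxx.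
Qed.

Lemma sign_label0 (R : realType) (x : R) : sign_label x = Zero -> x = 0.
Proof. by rewrite /sign_label; case: eqP. Qed.

(** * The coloring game and left kernels *)

Section ForcingKernel.
Variables (R : realType) (n : nat) (P : 'M[label]_n) (M : 'M[R]_n).
Hypothesis offdiag : forall i j, i != j -> P i j != Any.
Hypothesis patternM : has_sign_pattern P M.

Lemma signed_entry i j p : P i j = Signed p -> 0 < pm_sign R p * M i j.
Proof.
by move=> Pij; apply/sign_labelP; rewrite -patternM Pij.
Qed.

(** A node with an unknown self-loop acts only once it is black, and then it is
    not among its own white out-neighbors: every sign consulted is known. *)
Lemma white_out_signed st v u :
  may_act P st v -> u \in white_out P st v -> exists p, P u v = Signed p.
Proof.
move=> act; rewrite inE => /andP[Pnz whiteu].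
case Puv: (P u v) Pnz => [p||] // _; first by exists p.
have uv : u = v.
  by apply/eqP; apply: contraT => ne; have := offdiag ne; rewrite Puv.
by rewrite uv in Puv whiteu; move: act; rewrite /may_act Puv (negPf whiteu).
Qed.

Variable w : 'rV[R]_n.
Hypothesis kerw : w *m M = 0.

(** The invariant of the game for a left kernel vector [w].  Since [- w] lies in
    the kernel as well, the marks can only record the signs of the entries
    relative to each other, whence the global sign [sigma].  The inequality is
    weak because a node whose entry is zero may still be white and marked. *)
Definition compatible (st : state n) : Prop :=
  (forall u, is_black (st u) -> w 0 u = 0) /\
  exists2 sigma : R, sigma != 0 &
    forall u m, st u = White (Some m) -> 0 <= sigma * pm_sign R m * w 0 u.

(** This is column [v] of [w *m M = 0]: black nodes and missing edges
    contribute nothing. *)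
Lemma white_out_sum st v :
  (forall u, is_black (st u) -> w 0 u = 0) ->
  \sum_(u in white_out P st v) w 0 u * M u v = 0.
Proof.
move=> black0; have := congr1 (fun X : 'rV_n => X 0 v) kerw.
rewrite !mxE => kerwv.
rewrite -[RHS]kerwv [RHS](bigID (mem (white_out P st v))) /=.
rewrite [X in _ + X]big1 ?addr0 // => u.
rewrite inE negb_and !negbK => /orP[/eqP Pz|/black0->]; last by rewrite mul0r.
by rewrite (@sign_label0 R (M u v)) ?mulr0 // -patternM Pz.
Qed.

Lemma compatible_blacken (S : {set 'I_n}) st :
  (forall u, u \in S -> w 0 u = 0) ->
  compatible st -> compatible (blacken S st).
Proof.
move=> S0 [black0 [sigma sigma0 marks]]; split.
  by move=> u; rewrite /blacken; case: ifP => [/S0//|_ /black0].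
by exists sigma => // u m; rewrite /blacken; case: ifP => // _ /marks.
Qed.

Lemma marked_term_ge0 st v s u sigma :
  (forall u m, st u = White (Some m) -> 0 <= sigma * pm_sign R m * w 0 u) ->
  u \in white_out_marked P s st v ->
  0 <= sigma * pm_sign R s * (w 0 u * M u v).
Proof.
move=> marks; rewrite inE => /andP[_].
case stu: (st u) => [|[m|]] // /eqP /signed_entry; rewrite pm_signM => posM.
have -> : sigma * pm_sign R s * (w 0 u * M u v) =
    (sigma * pm_sign R m * w 0 u) * (pm_sign R s * pm_sign R m * M u v).
  by rewrite -[LHS]mulr1 -(pm_sign_sqr R m); ring.
by rewrite mulr_ge0 ?marks // ltW.
Qed.

(** Each move reads off consequences of the vanishing sum [white_out_sum]: a
    single term is zero, terms of one sign are all zero, and a single term of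
    unknown sign has the sign opposite to that of all the others.  The first
    mark is a choice of [sigma]. *)
Lemma compatible_move st st' : move P st st' -> compatible st -> compatible st'.
Proof.
have nz v u p : P u v = Signed p -> M u v != 0.
  by move=> /signed_entry; apply: contraTneq => ->; rewrite mulr0 ltxx.
move=> + cst; have [black0 [sigma sigma0 marks]] := cst; case.
- move=> v u act Wu; apply: compatible_blacken cst => x /set1P->.
  have := white_out_sum v black0; rewrite Wu big_set1 => /eqP.
  have [p /nz Muv] : exists p, P u v = Signed p.
    by apply: white_out_signed act _; rewrite Wu set11.
  by rewrite mulf_eq0 (negPf Muv) orbF => /eqP.
- move=> v s act Ws; apply: compatible_blacken cst => u uW.
  have sum0 :
      \sum_(u in white_out P st v) sigma * pm_sign R s * (w 0 u * M u v) = 0.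
    by rewrite -mulr_sumr white_out_sum ?mulr0.
  have ge0 x : x \in white_out P st v ->
      0 <= sigma * pm_sign R s * (w 0 x * M x v).
    by rewrite -Ws => /(marked_term_ge0 marks).
  have /(_ u uW)/eqP := psumr_eq0P ge0 sum0.
  have [p /nz Muv] := white_out_signed act uW.
  have s0 : pm_sign R s != 0 by case: (s); rewrite /= ?oppr_eq0 oner_eq0.
  by rewrite !mulf_eq0 (negPf Muv) (negPf sigma0) (negPf s0) /= orbF => /eqP.
- move=> v s x p act _ Wv Wx Pxv; split.
    by move=> u; rewrite /mark; case: ifP => // _ /black0.
  exists sigma => // u m; rewrite /mark; case: eqP => [-> [<-]|_ /marks//].
  have xW : x \in white_out P st v.
    have : x \in white_out_unmarked P st v by rewrite Wx set11.
    by rewrite inE => /andP[].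
  have := white_out_sum v black0.
  rewrite (bigD1 x) //= => /(congr1 ( *%R (sigma * pm_sign R s))).
  rewrite mulr0 mulrDr mulr_sumr => sum0.
  (* [x] is the only term of unknown sign and no term has the other sign. *)
  have rest_ge0 : 0 <= \sum_(i in white_out P st v | i != x)
      sigma * pm_sign R s * (w 0 i * M i v).
    apply: sumr_ge0 => i /andP[iW ix]; apply: marked_term_ge0 marks _.
    have [r Piv] := white_out_signed act iW.
    have : i \notin white_out_unmarked P st v by rewrite Wx inE.
    have : i \notin white_out_marked P (inv_pm s) st v by rewrite Wv inE.
    rewrite !inE in iW *; rewrite iW /= /is_unmarked Piv.
    move: iW => /andP[_]; case: (st i) => [|[m'|]] //= _ + _.
    by case: (s); case: (m'); case: (r).
  have := signed_entry Pxv; rewrite pm_signM pm_signV => posM.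
  rewrite -(pmulr_lge0 _ posM).
  have -> : sigma * (pm_sign R p * - pm_sign R s) * w 0 x *
      (pm_sign R p * M x v) =
      - (pm_sign R p * pm_sign R p) * (sigma * pm_sign R s * (w 0 x * M x v)).
    by ring.
  rewrite pm_sign_sqr; lra.
- move=> u unmarked whiteu; split.
    by move=> x; rewrite /mark; case: ifP => // _ /black0.
  exists (if 0 <= w 0 u then 1 else -1).
    by case: ifP; rewrite ?oppr_eq0 oner_eq0.
  move=> x m; rewrite /mark; case: eqP => [-> [<-] /=|_ stx].
    by rewrite mulr1; case: ifP => [|/negbT]; lra.
  by have := unmarked x; rewrite stx.
Qed.

Lemma forcing_kernel (Z : {set 'I_n}) :
  forces_all P Z -> (forall u, u \in Z -> w 0 u = 0) -> w = 0.
Proof.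
move=> [st [moves allblack]] w0.
suff [black0 _] : compatible st by apply/rowP => u; rewrite mxE black0.
have : compatible (initial_state Z).
  split; first by move=> u; rewrite /initial_state; case: ifP => // /w0.
  by exists 1; [exact: oner_neq0|move=> u m; rewrite /initial_state; case: ifP].
elim: {allblack} moves => // x y z /compatible_move xy _ IH /xy; exact: IH.
Qed.

End ForcingKernel.

(** * Shifting the spectrum *)

Lemma looped_offdiag n s (P : 'M[label]_n) :
  (forall i j, i != j -> P i j != Any) ->
  forall i j, i != j -> looped_pattern s P i j != Any.
Proof. by move=> off i j ij; rewrite mxE (negPf ij) off. Qed.

Lemma looped_pattern_shift (R : realType) n s (P : 'M[label]_n)
    (A : 'M[R]_n) d :
  has_sign_pattern P A -> 0 < pm_sign R s * d ->
  has_sign_pattern (looped_pattern s P) (A + d%:M).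
Proof.
move=> PA dpos i j; rewrite !mxE; case: (i =P j) => [<-|_].
  2: by rewrite mulr0n addr0 => Pij; apply: PA.
rewrite mulr1n; have := PA i i; case: (P i i) => [r||] // /(_ isT)/esym.
- move=> /sign_labelP rA /=; case: (r =P s) => // rs _; apply/esym/sign_labelP.
  by rewrite mulrDr addr_gt0 // rs.
- by move=> /sign_label0-> _; rewrite add0r; apply/esym/sign_labelP.
Qed.

(** A left eigenvector of [A] for [l] is a left kernel vector of [A - l I],
    whose sign pattern is that of [A] with the sign of [- l] added on the
    diagonal; the three games cover the three signs of [l]. *)
Lemma zero_forcing_left_eigenvector (R : realType) n (G : signed_graph n)
    (Z : {set 'I_n}) (A : 'M[R]_n) (l : R) (w : 'rV[R]_n) :
  signed_zfs G Z -> positive_signed_zfs G Z -> negative_signed_zfs G Z ->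
  has_sign_pattern (pattern G) A -> w *m A = l *: w ->
  (forall u, u \in Z -> w 0 u = 0) -> w = 0.
Proof.
move=> zfs0 zfsP zfsN PA wA.
have kerw : w *m (A + (- l)%:M) = 0.
  by rewrite mulmxDr wA mul_mx_scalar scaleNr subrr.
have off := @pattern_offdiag _ G.
have [l0|l0|l0] := ltrgtP l 0.
- apply: forcing_kernel kerw _ zfsN; first exact: looped_offdiag.
  by apply: looped_pattern_shift => //=; lra.
- apply: forcing_kernel kerw _ zfsP; first exact: looped_offdiag.
  by apply: looped_pattern_shift => //=; lra.
- by apply: (forcing_kernel off PA _ zfs0) => //; rewrite wA l0 scale0r.
Qed.

(** * From the eigenvector test to the rank condition *)

Lemma real_char_poly_split (R : realType) n (A : 'M[R]_n) :
  only_real_eigenvalues A ->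
  exists rs : seq R, char_poly A = \prod_(r <- rs) ('X - r%:P).
Proof.
move=> realA; set AC := map_mx (real_complex R) A.
have [zs zsE] := closed_field_poly_normal (char_poly AC).
rewrite (monicP (char_poly_monic _)) scale1r in zsE.
exists [seq complex.Re z | z <- zs]; apply: (map_poly_inj (real_complex R)).
rewrite map_char_poly zsE rmorph_prod /= big_map big_seq [RHS]big_seq.
apply: eq_bigr => z zzs; rewrite rmorphB /= map_polyX map_polyC /=.
congr (_ - _%:P); apply/eqP; rewrite eq_complex /= eqxx /=; apply/eqP/realA.
by rewrite /complex_eigenvalue eigenvalue_root_char -/AC zsE root_prod_XsubC.
Qed.

(** Multiply [w] by the factors [A - r] one at a time; the last nonzero product
    is an eigenvector for the next root.  The bound on [size q] says that
    [q] has degree less than the number of roots, so the eigenvector is a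
    combination of the [w *m A ^+ k] with [k < size rs]. *)
Lemma left_eigenvector_in_orbit (F : fieldType) n (A : 'M[F]_n.+1)
    (rs : seq F) (w : 'rV[F]_n.+1) :
  w != 0 -> w *m horner_mx A (\prod_(r <- rs) ('X - r%:P)) = 0 ->
  exists (q : {poly F}) (l : F),
  [/\ (size q <= size rs)%N, w *m horner_mx A q != 0 &
     w *m horner_mx A q *m A = l *: (w *m horner_mx A q)].
Proof.
move=> w0; elim: rs => [|r rs IH].
  by rewrite big_nil rmorph1 mulmx1 => /eqP; rewrite (negPf w0).
set q := \prod_(i <- rs) ('X - i%:P) in IH *; rewrite big_cons -/q.
have [/IH[q' [l [s1 s2 s3]]] _|wq0] := eqVneq (w *m horner_mx A q) 0.
  by exists q', l; split=> //; apply: leqW.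
rewrite mulrC rmorphM rmorphB /= horner_mx_X horner_mx_C -mulmxE mulmxA.
rewrite mulmxBr mul_mx_scalar => /eqP; rewrite subr_eq0 => /eqP wqA.
by exists q, r; split; rewrite // size_prod_XsubC.
Qed.

(** If the images of the [A ^+ k *m B] do not span the space, a row vector [w]
    annihilates them all, and so does the eigenvector found among the
    polynomial multiples of [w].  As the roots of [char_poly A] are real, this
    eigenvector is real and no complex vectors are needed.  The matrices [N k]
    express the spanning as a right inverse, which is how it is used for
    steering. *)
Lemma kalman_rank_real (R : realType) n m (A : 'M[R]_n) (B : 'M[R]_(n, m)) :
  only_real_eigenvalues A ->
  (forall l (w : 'rV[R]_n), w *m A = l *: w -> w *m B = 0 -> w = 0) ->
  exists N : 'I_n -> 'M[R]_(m, n),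
    \sum_(k < n) A ^+ k *m B *m N k = 1%:M.
Proof.
case: n A B => [|n] A B realA pbh.
  by exists (fun=> 0); rewrite [LHS]flatmx0 [RHS]flatmx0.
pose S := (\sum_(k < n.+1) <<(A ^+ k *m B)^T>>)%MS.
have [fullS|defS] := boolP (row_full S).
  have /sub_sumsmxP[u uE] : (1%:M <= S)%MS by rewrite sub1mx.
  have subk (k : 'I_n.+1) :
      exists D, <<(A ^+ k *m B)^T>>%MS = D *m (A ^+ k *m B)^T.
    by apply/submxP; rewrite genmxE.
  have {subk}[D DE] := fin_all_exists subk.
  exists (fun k : 'I_n.+1 => (u k *m D k)^T).
  apply: trmx_inj; rewrite trmx1 uE linear_sum; apply: eq_bigr => k _ /=.
  by rewrite trmx_mul trmxK -mulmxA -DE.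
have : kermx S^T != 0.
  rewrite kermx_eq0 -row_leq_rank mxrank_tr -ltnNge ltn_neqAle.
  by rewrite rank_leq_col andbT.
case/rowV0Pn => w /sub_kermxP wS w0.
have wk k : (k < n.+1)%N -> w *m A ^+ k *m B = 0.
  move=> kn; apply: trmx_inj; rewrite trmx0 -mulmxA trmx_mul.
  have /submxP[D ->] : ((A ^+ k *m B)^T <= S)%MS.
    apply: submx_trans (sumsmx_sup (Ordinal kn) _ (submx_refl _)) => //.
    by rewrite genmxE.
  by rewrite -mulmxA -[S in _ *m (S *m _)]trmxK -trmx_mul wS trmx0 mulmx0.
have [rs rsE] := real_char_poly_split realA.
have rs_size : size rs = n.+1.
  by have := size_char_poly A; rewrite rsE size_prod_XsubC => -[].
have := Cayley_Hamilton A; rewrite rsE => CH.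
have [|q [l [qsz wq wqA]]] := left_eigenvector_in_orbit w0 (rs := rs) (A := A).
  by rewrite CH mulmx0.
case/eqP: wq; apply: pbh wqA _.
rewrite -[q]coefK poly_def rmorph_sum /= mulmx_sumr mulmx_suml big1 // => i _.
rewrite linearZ /= rmorphXn /= horner_mx_X -scalemxAr -scalemxAl wk ?scaler0 //.
by rewrite -rs_size (leq_trans (ltn_ord i)).
Qed.

(** * Steering along polynomial trajectories *)

Section Steering.
Variables (R : realType) (n m : nat) (A : 'M[R]_n) (B : 'M[R]_(n, m)).

Definition deriv_mx p r (X : 'M[{poly R}]_(p, r)) := map_mx (@deriv R) X.
Definition eval_mx p r (X : 'M[{poly R}]_(p, r)) t := map_mx (fun f => f.[t]) X.
Definition polyC_mx p r (X : 'M[R]_(p, r)) := map_mx polyC X.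

Lemma deriv_mxD p r (X Y : 'M[{poly R}]_(p, r)) :
  deriv_mx (X + Y) = deriv_mx X + deriv_mx Y.
Proof. by apply/matrixP => i k; rewrite !mxE derivD. Qed.

Lemma deriv_mx0 p r : deriv_mx (0 : 'M[{poly R}]_(p, r)) = 0.
Proof. by apply/matrixP => i k; rewrite !mxE derivC. Qed.

Lemma deriv_mxZ p r (f : {poly R}) (X : 'M[{poly R}]_(p, r)) :
  deriv_mx (f *: X) = f^`() *: X + f *: deriv_mx X.
Proof. by apply/matrixP => i k; rewrite !mxE derivM. Qed.

Lemma deriv_mxM p r q (X : 'M[R]_(p, r)) (Y : 'M[{poly R}]_(r, q)) :
  deriv_mx (polyC_mx X *m Y) = polyC_mx X *m deriv_mx Y.
Proof.
apply/matrixP => i k; rewrite !mxE raddf_sum; apply: eq_bigr => l _.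
by rewrite !mxE /= derivM derivC mul0r add0r.
Qed.

Lemma eval_mxD p r (X Y : 'M[{poly R}]_(p, r)) t :
  eval_mx (X + Y) t = eval_mx X t + eval_mx Y t.
Proof. by apply/matrixP => i k; rewrite !mxE hornerD. Qed.

Lemma eval_mxZ p r (f : {poly R}) (X : 'M[{poly R}]_(p, r)) t :
  eval_mx (f *: X) t = f.[t] *: eval_mx X t.
Proof. by apply/matrixP => i k; rewrite !mxE hornerM. Qed.

Lemma eval_mxM p r q (X : 'M[R]_(p, r)) (Y : 'M[{poly R}]_(r, q)) t :
  eval_mx (polyC_mx X *m Y) t = X *m eval_mx Y t.
Proof.
apply/matrixP => i k; rewrite !mxE horner_sum; apply: eq_bigr => l _.
by rewrite !mxE hornerM hornerC.
Qed.

Lemma eval_polyC_mx p r (X : 'M[R]_(p, r)) t : eval_mx (polyC_mx X) t = X.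
Proof. by apply/matrixP => i k; rewrite !mxE hornerC. Qed.

Lemma polyC_mxM p r q (X : 'M[R]_(p, r)) (Y : 'M[R]_(r, q)) :
  polyC_mx (X *m Y) = polyC_mx X *m polyC_mx Y.
Proof. exact: map_mxM. Qed.

Lemma is_derive_eval_mx p r (X : 'M[{poly R}]_(p, r)) (t : R) :
  is_derive t 1 (eval_mx X) (eval_mx (deriv_mx X) t).
Proof.
have entry i k : (fun s => eval_mx X s i k) = horner (X i k).
  by apply: boolp.funext => s; rewrite mxE.
have derX : derivable (eval_mx X) t 1.
  by apply/derivable_mxP => i k; rewrite entry; apply: derivable_horner.
apply: DeriveDef => //; rewrite derive_mx //; apply/matrixP => i k.
by rewrite !mxE entry derive_val.
Qed.

Lemma continuous_eval_mx p r (X : 'M[{poly R}]_(p, r)) : continuous (eval_mx X).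
Proof.
move=> t; apply: differentiable_continuous; apply/derivable1_diffP.
exact: (@ex_derive _ _ _ _ _ _ _ (is_derive_eval_mx X t)).
Qed.

(** Zero defect means a trajectory of the uncontrolled system; an input can
    produce exactly the defects that lie in the range of [B]. *)
Definition defect (x : 'cV[{poly R}]_n) := deriv_mx x - polyC_mx A *m x.

Lemma defectD x y : defect (x + y) = defect x + defect y.
Proof. by rewrite /defect deriv_mxD mulmxDr opprD addrACA. Qed.

Lemma defect_sum (I : finType) (x : I -> 'cV[{poly R}]_n) :
  defect (\sum_i x i) = \sum_i defect (x i).
Proof.
apply: (big_morph defect defectD).
by rewrite /defect deriv_mx0 mulmx0 subrr.
Qed.

(** Multiples of [q01] vanish at the two ends of the time interval, so adding
    them to a curve keeps its endpoints. *)
Definition q01 : {poly R} := 'X * ('X - 1).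

(** Modulo [q01], the derivative of [q01] is its own inverse; this makes the
    corrections of [endpoints_with_flat_defect] explicit. *)
Lemma q01_sqr : q01^`() ^+ 2 = 1 + 4%:P * q01.
Proof.
have -> : q01^`() = 'X + ('X - 1).
  by rewrite /q01 derivM derivB derivX derivC subr0 mul1r mulr1 addrC.
by rewrite /q01 polyC_natr; ring.
Qed.

(** Newton-like correction: if the defect of [w] is [q01 ^+ N *: g], adding
    [q01 ^+ N.+1 *: c] changes it by [N.+1 * q01 ^+ N * q01^`() *: c] up to
    multiples of [q01 ^+ N.+1], so one has to solve
    [N.+1 * q01^`() *: c = - g] modulo [q01]. *)
Lemma endpoints_with_flat_defect (x0 x1 : 'cV[R]_n) N :
  exists w g,
  [/\ eval_mx w 0 = x0, eval_mx w 1 = x1 & defect w = q01 ^+ N *: g].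
Proof.
elim: N => [|N [w [g [w0 w1 wg]]]].
  exists ((1 - 'X) *: polyC_mx x0 + 'X *: polyC_mx x1); eexists; split.
  - rewrite eval_mxD !eval_mxZ !eval_polyC_mx !hornerE.
    by rewrite subr0 scale1r scale0r addr0.
  - rewrite eval_mxD !eval_mxZ !eval_polyC_mx !hornerE.
    by rewrite subrr scale1r scale0r add0r.
  - by rewrite expr0 scale1r.
pose c := (- N.+1%:R^-1)%:P *: (q01^`() *: g).
have q0 : q01.[0] = 0 by rewrite !hornerE.
have q1 : q01.[1] = 0 by rewrite !hornerE subrr.
exists (w + q01 ^+ N.+1 *: c), (- 4%:P *: g + defect c); split.
- by rewrite eval_mxD eval_mxZ w0 horner_exp q0 expr0n scale0r addr0.
- by rewrite eval_mxD eval_mxZ w1 horner_exp q1 expr0n scale0r addr0.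
rewrite defectD wg {1}/defect deriv_mxZ deriv_exp -scalemxAr.
rewrite -addrA -scalerBr -/(defect c).
rewrite addrA [RHS]scalerDr; congr (_ + _).
rewrite /c !scalerA -scalerDl; congr (_ *: _).
have cN : N.+1%:R * (- N.+1%:R^-1)%:P = -1 :> {poly R}.
  by rewrite -polyC_natr -polyCM mulrN mulfV ?pnatr_eq0 // polyCN.
rewrite -mulr_natl exprS.
have -> : N.+1%:R * (q01^`() * q01 ^+ N) * (- N.+1%:R^-1)%:P * q01^`() =
  (N.+1%:R * (- N.+1%:R^-1)%:P) * q01^`() ^+ 2 * q01 ^+ N by ring.
rewrite cN q01_sqr; ring.
Qed.

(** For [f = q01 ^+ k.+2 *: g], adding [A ^+ k *m B *m f] to a curve trades a
    defect [A ^+ k.+1 *m B *m f] for [A ^+ k *m B] times the derivative of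
    [f].  After [k] such steps the defect lies in the range of [B]; each step
    costs one derivative, hence one factor [q01], and one factor must be left
    for the correction to vanish at the endpoints. *)
Lemma absorb_reachable_direction k (g : 'cV[{poly R}]_m) :
  exists z v, defect (q01 *: z) + polyC_mx (A ^+ k *m B) *m (q01 ^+ k.+1 *: g)
    = polyC_mx B *m v.
Proof.
elim: k g => [|k IH] g.
  exists 0, (q01 ^+ 1 *: g).
  by rewrite expr0 mul1mx scaler0 /defect deriv_mx0 mulmx0 subrr add0r.
pose AkB := A ^+ k *m B.
pose dg := (k.+2%:R * q01^`()) *: g + q01 *: deriv_mx g.
have dgE : deriv_mx (q01 ^+ k.+2 *: g) = q01 ^+ k.+1 *: dg.
  rewrite deriv_mxZ deriv_exp -mulr_natl /= scalerDr !scalerA -exprSr.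
  by congr (_ *: _ + _); ring.
have [z [v zv]] := IH dg.
exists (polyC_mx AkB *m (q01 ^+ k.+1 *: g) + z), v.
rewrite scalerDr defectD scalemxAr scalerA -exprS -zv {1}/defect deriv_mxM dgE.
rewrite [A ^+ k.+1]exprS -[A * _]/(A *m _) -[A *m _ *m B]mulmxA.
rewrite polyC_mxM -!mulmxA -/AkB.
set a := _ *m _; set b := _ *m _; set c := defect _.
by rewrite addrAC subrK addrC.
Qed.

(** Start from a curve with the right endpoints and a defect divisible by
    [q01 ^+ K], split the defect along the [A ^+ k *m B] by means of [N], and
    absorb each part. *)
Lemma kalman_rank_controllable (K : nat) (N : 'I_K -> 'M[R]_(m, n)) :
  \sum_(k < K) A ^+ k *m B *m N k = 1%:M -> controllable A B.
Proof.
move=> rankN x0 x1.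
have [w [g [w0 w1 wg]]] := endpoints_with_flat_defect x0 x1 K.
pose h (k : 'I_K) := q01 ^+ (K - k.+1) *: (polyC_mx (N k) *m g).
have absorb (k : 'I_K) : exists zv : 'cV_n * 'cV_m, defect (q01 *: zv.1) =
   polyC_mx B *m zv.2 - polyC_mx (A ^+ k *m B) *m (q01 ^+ k.+1 *: h k).
  have [z [v zv]] := absorb_reachable_direction k (h k).
  by exists (z, v); rewrite -zv /= addrK.
have {absorb}[zv zvE] := fin_all_exists absorb.
pose x := w + \sum_k q01 *: (zv k).1.
pose u := \sum_k (zv k).2.
have sum_h : \sum_(k < K) polyC_mx (A ^+ k *m B) *m (q01 ^+ k.+1 *: h k)
    = q01 ^+ K *: g.
  rewrite -[g in RHS]mul1mx -(map_mx1 polyC) -rankN raddf_sum mulmx_suml.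
  rewrite scaler_sumr.
  apply: eq_bigr => k _; rewrite /h scalerA -exprD subnKC // -scalemxAr mulmxA.
  by rewrite -polyC_mxM.
have defx : defect x = polyC_mx B *m u.
  rewrite defectD defect_sum wg (eq_bigr _ (fun k _ => zvE k)) sumrB.
  by rewrite -mulmx_sumr sum_h addrC subrK.
have q_ends t : q01.[t] = 0 -> eval_mx x t = eval_mx w t.
  by move=> qt; rewrite /x -scaler_sumr eval_mxD eval_mxZ qt scale0r addr0.
exists 1, (eval_mx u), (eval_mx x); split => //.
- exact: continuous_eval_mx.
- move=> t.
  have -> : A *m eval_mx x t + B *m eval_mx u t = eval_mx (deriv_mx x) t.
    by rewrite -!eval_mxM -eval_mxD -defx addrC subrK.
  exact: is_derive_eval_mx.
- by rewrite q_ends // !hornerE.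
- by rewrite q_ends // !hornerE subrr.
Qed.

End Steering.

(** * Controllability *)

Local Close Scope ring_scope.

Theorem theorem3 (R : realType) (n m : nat) (G : signed_graph n)
    (VC : {set 'I_n}) (j : 'I_m -> 'I_n)
    (hVC : VC = [set j k | k : 'I_m]%SET)
    (hreal : forall A : 'M[R]_n, qualitative_class G A -> only_real_eigenvalues A)
    (hzero : signed_zfs G VC)
    (hpos : positive_signed_zfs G VC)
    (hneg : negative_signed_zfs G VC) :
  forall A : 'M[R]_n, qualitative_class G A ->
    forall l : R[i]%C, complex_eigenvalue A l ->
      controllable_eigenvalue A (control_matrix R j) l.
Proof.
move=> A [PA symA] l lA; split=> //; left.
have realA := hreal A (conj PA symA).
have [|N] := kalman_rank_real (B := control_matrix R j) realA.
  move=> r w wA wB.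
  apply: zero_forcing_left_eigenvector hzero hpos hneg PA wA _.
  move=> u; rewrite hVC => /imsetP[k _ ->].
  have := congr1 (fun X : 'rV[R]_m => X 0 k)%R wB; rewrite !mxE => <-.
  rewrite (bigD1 (j k)) //= big1 => [|i ik]; rewrite mxE.
    by rewrite eqxx mulr1 addr0.
  by rewrite (negPf ik) mulr0.
exact: kalman_rank_controllable.
Qed.
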